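(* Let $H$ be a real Hilbert space, and let $A$ be a nonnegative self-adjoint (unbounded) linear operator on $H$ with dense domain $D(A)$. Let $m:[0,+\infty)\to[0,+\infty)$ be a continuous function, and let $b:[0,+\infty)\to(0,+\infty)$ be a continuous function such that $$\int_{0}^{+\infty}b(s)\,ds<+\infty.$$ Let $(u_{0},u_{1})\in D(A)\times D(A^{1/2})$ be such that $$|u_{1}|^{2}+\int_{0}^{|A^{1/2}u_{0}|^{2}}m(\sigma)\,d\sigma>0.$$ Assume that for some $\varepsilon>0$ the problem $$\varepsilon u_{\varepsilon}''(t)+b(t)u_{\varepsilon}'(t)+m(|A^{1/2}u_{\varepsilon}(t)|^{2})Au_{\varepsilon}(t)=0\quad\forall t\geq 0,\qquad u_{\varepsilon}(0)=u_{0},\quad u_{\varepsilon}'(0)=u_{1},$$ has a global solution $$u_{\varepsilon}\in C^{2}([0,+\infty);H)\cap C^{1}([0,+\infty);D(A^{1/2}))\cap C^{0}([0,+\infty);D(A)).$$ Then $$\liminf_{t\to+\infty}\left(|u_{\varepsilon}'(t)|^{2}+|A^{1/2}u_{\varepsilon}(t)|^{2}\right)>0.$$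
   Context: $|x|$ and $\langle x,y\rangle$ denote the norm and scalar product of the real Hilbert space $H$. Nonnegative means $\langle Ax,x\rangle\geq 0$ for every $x\in D(A)$; for $\alpha\geq 0$ the power $A^{\alpha}$ with domain $D(A^{\alpha})$ is defined by the spectral theory of self-adjoint operators. $D(A)$ and $D(A^{1/2})$ are endowed with their graph norms. *)

(* Defs.v *)
From HB Require Import structures.
From mathcomp Require Import all_boot all_order all_algebra.
From mathcomp Require Import all_classical all_reals all_analysis.

Set Implicit Arguments.
Unset Strict Implicit.
Unset Printing Implicit Defensive.

Import Order.TTheory GRing.Theory Num.Theory.
Import numFieldNormedType.Exports.

Local Open Scope classical_set_scope.
Local Open Scope ring_scope.

(* A real Hilbert space is a complete normed module H together with a library
   inner product [dot] that induces its norm. *)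
Definition induces_norm (R : realType) (H : completeNormedModType R)
    (dot : {dot H for (idfun : R -> R)}) : Prop :=
  forall x : H, dot x x = `|x| ^+ 2.

(* The values of [app] outside [dom] are irrelevant. *)
Record operator (R : realType) (H : completeNormedModType R) := Operator {
  dom : set H;
  app :> H -> H;
  dom0 : dom 0;
  dom_linear : forall (a : R) x y, dom x -> dom y -> dom (a *: x + y);
  app_linear : forall (a : R) x y, dom x -> dom y ->
    app (a *: x + y) = a *: app x + app y }.

Section Operators.
Context (R : realType) (H : completeNormedModType R).
Variable dot : {dot H for (idfun : R -> R)}.
Implicit Types (A B : operator H) (x y z : H).

(* [adjoint_graph A y z] means that y is in D(A^* ) and A^* y = z; for densely
   defined A such a z is unique. *)
Definition adjoint_graph A y z : Prop :=
  forall x, dom A x -> dot (A x) y = dot x z.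

Definition self_adjoint A : Prop :=
  dense (dom A) /\
  forall y z, adjoint_graph A y z <-> dom A y /\ z = A y.

Definition nonnegative A : Prop := forall x, dom A x -> 0 <= dot (A x) x.

Definition graph_norm A x : R := Num.sqrt (`|x| ^+ 2 + `|A x| ^+ 2).

Definition orthogonal_projection (P : H -> H) : Prop :=
  [/\ linear P, forall x, P (P x) = P x & forall x y, dot (P x) y = dot x (P y)].

(* Resolution of the identity on the Borel sets of R; countable additivity is
   in the strong operator topology. *)
Record spectral_measure (E : set R -> H -> H) : Prop := SpectralMeasure {
  spectral_proj : forall S, measurable S -> orthogonal_projection (E S);
  spectral_setT : forall x, E setT x = x;
  spectral_setI : forall S T x, measurable S -> measurable T ->
    E (S `&` T) x = E S (E T x);
  spectral_sigma_additive : forall (F : (set R)^nat) x,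
    (forall n, measurable (F n)) -> trivIset setT F ->
    (fun n => \sum_(0 <= k < n) E (F k) x) @ \oo --> E (\bigcup_n F n) x }.

(* The scalar measure S |-> <E(S) x, x>. *)
Definition scalar_measure (E : set R -> H -> H) x (S : set R) : \bar R :=
  (dot (E S x) x)%:E.

(* B is the integral of f with respect to E:
   D(B) = {x | int f^2 d<E x, x> is finite}, and <B x, y> = int f d<E x, y> for
   x, y in D(B), where <E x, y> is written as a difference of two finite
   measures by polarization. As D(B) is dense, this determines B. *)
Definition is_spectral_integral (E : set R -> H -> H) (f : R -> R) B : Prop :=
  (forall x, dom B x <->
     (\int[scalar_measure E x]_l ((f l) ^+ 2)%:E < +oo)%E) /\
  forall x y, dom B x -> dom B y ->
    ((4 * dot (B x) y)%:E =
       \int[scalar_measure E (x + y)%R]_l (f l)%:E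
       - \int[scalar_measure E (x - y)%R]_l (f l)%:E)%E.

(* B = A^alpha for a nonnegative self-adjoint A, whose resolution of the
   identity lives on [0, +oo[. *)
Definition is_power A (alpha : R) B : Prop :=
  exists E : set R -> H -> H,
    [/\ spectral_measure E,
        forall x, E `[0, +oo[%classic x = x,
        is_spectral_integral E id A &
        is_spectral_integral E (fun l => l `^ alpha) B].

(* v is the derivative of u on [0, +oo[ (right derivative at 0) for the
   norm N. *)
Definition has_derivative (N : H -> R) (u v : R -> H) : Prop :=
  forall t, 0 <= t ->
    N ((s - t)^-1 *: (u s - u t) - v t)
      @[s --> within [set s | 0 <= s /\ s != t] (nbhs t)] --> (0 : R).

(* u belongs to C^k([0, +oo[; (D, N)), D being a subspace with norm N. *)
Fixpoint Ck (D : set H) (N : H -> R) (k : nat) (u : R -> H) : Prop :=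
  (forall t, 0 <= t -> D (u t)) /\
  match k with
  | 0%N => forall t, 0 <= t ->
      N (u s - u t) @[s --> within [set s | 0 <= s] (nbhs t)] --> (0 : R)
  | k'.+1 => exists2 v, has_derivative N u v & Ck D N k' v
  end.

(* The derivative of u on [0, +oo[, in the norm of H. *)
Definition derivative (u : R -> H) (t : R) : H :=
  lim ((s - t)^-1 *: (u s - u t)
         @[s --> within [set s | 0 <= s /\ s != t] (nbhs t)]).

End Operators.

(* Main.v *)
Require Import Defs.
From HB Require Import structures.
From mathcomp Require Import all_boot all_order all_algebra.
From mathcomp Require Import all_classical all_reals all_analysis.
From mathcomp Require Import measurable_realfun.
From mathcomp Require Import ring lra.

(** Along a solution the energy e = eps |u'|^2 + M(|A^(1/2) u|^2), where M is
    the antiderivative of m vanishing at 0, satisfies e' = - 2 b |u'|^2, and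
    this is at least - (2 b / eps) e because M is nonnegative. Hence
    e(t) exp((2 / eps) int_0^t b) is nondecreasing ([gronwall_lower_bound]).
    As b has a finite integral, e is bounded below by a positive constant:
    the damping fades too quickly to exhaust the energy. If |u'|^2 and
    |A^(1/2) u|^2 were both small at some time, then so would be the energy,
    since M is continuous and vanishes at 0.

    The identity for e' needs 2 <A u, u'> as the derivative of |A^(1/2) u|^2.
    On the domain of A, |A^(1/2) x|^2 = <A x, x> ([norm_sqr_spectral_sqrt]),
    and the symmetry of A together with the continuity of A u is enough to
    differentiate this quadratic form along u: its difference quotient is
    <A u(s) + A u(t), (u(s) - u(t)) / (s - t)> ([derivative_at_dot]).

    The identity |A^(1/2) x|^2 = <A x, x> is extracted from the weak
    definition of a spectral integral, which gives only the numbers <B x, y>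
    for x and y in the domain of B = int f dE. Write mu_x for the measure
    S |-> <E(S) x, x>. The definition says that <B x, y> is the integral of f
    against the polarized set function S |-> <E(S) x, y>. If that function has
    density g with respect to some mu_z, then <B x, y> = int g f dmu_z
    ([spectral_integral_dot_density]). Let D be a set where f is bounded.
    Taking y = E(S) x with S inside D, where the density is the indicator of
    S, gives <B x, E(S) x> = int_S f dmu_x; this means that
    S |-> <E(S) x, E(D) B x> has density f on D and 0 elsewhere, so that the
    same statement with y = E(D) B x gives
    <B x, E(D) B x> = int_D f^2 dmu_x. Exhausting the line by such sets D gives
    |B x|^2 = int f^2 dmu_x ([spectral_integral_norm]). *)

Import Order.TTheory GRing.Theory Num.Theory.
Import numFieldNormedType.Exports.

Local Open Scope classical_set_scope.
Local Open Scope ring_scope.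

Set Implicit Arguments.
Unset Strict Implicit.

(** * Integration against a measure with a density *)

Section density.
Context {d} {T : measurableType d} {R : realType}.
Variables mu mu1 mu2 : {measure set T -> \bar R}.
Variable g : T -> R.
Hypothesis mg : measurable_fun [set: T] g.
Hypothesis g0 : forall x, 0 <= g x.
Hypothesis mu1E : forall S, measurable S ->
  (mu1 S = mu2 S + \int[mu]_(x in S) (g x)%:E)%E.

Import HBNNSimple.

Let density_nnsfun (h : {nnsfun T >-> R}) :
  (\int[mu1]_x (h x)%:E =
   \int[mu2]_x (h x)%:E + \int[mu]_x ((g x)%:E * (h x)%:E))%E.
Proof.
have mg' : measurable_fun [set: T] (EFin \o g).
  exact/measurable_EFinP.
under eq_integral do rewrite fimfunE -fsumEFin//.
under [X in (_ = X + _)%E]eq_integral do rewrite fimfunE -fsumEFin//.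
under [X in (_ = _ + X)%E]eq_integral.
  move=> x _; rewrite fimfunE -fsumEFin// ge0_mule_fsumr; last first.
    by move=> r; rewrite EFinM nnfun_muleindic_ge0.
  over.
have mi r : measurable_fun [set: T]
    (EFin \o fun x => r * \1_(h @^-1` [set r]) x).
  by apply/measurable_EFinP; exact/measurableT_comp.
have i0 r x : (0 <= (r * \1_(h @^-1` [set r]) x)%:E :> \bar R)%E.
  by rewrite EFinM nnfun_muleindic_ge0.
rewrite !ge0_integral_fsum//; last 2 first.
  - by move=> r; apply: emeasurable_funM; [exact: mg'|exact: mi].
  - by move=> r x _; rewrite mule_ge0// lee_fin.
rewrite -fsbig_split//=; apply: eq_fsbigr => r _.
have mr : measurable (h @^-1` [set r]) by [].
rewrite [X in (_ = _ + X)%E](_ : _ =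
    \int[mu]_x (r%:E * ((EFin \o g) \_ (h @^-1` [set r])) x))%E; last first.
  apply: eq_integral => x _; rewrite patchE indicE /=.
  by case: (x \in _); rewrite ?mulr1 ?mulr0 ?mule0// muleC.
have [hr|hr] := eqVneq (h @^-1` [set r]) set0.
  rewrite hr indic0 patch_set0.
  under eq_integral do rewrite mulr0.
  under [X in (_ = X + _)%E]eq_integral do rewrite mulr0.
  under [X in (_ = _ + X)%E]eq_integral do rewrite mule0.
  by rewrite !integral0 adde0.
have r0 : (0 <= r)%R.
  by move/set0P: hr => [x /= <-]; exact: fun_ge0.
rewrite [X in (_ = _ + X)%E]ge0_integralZl//; first last.
- by move=> x _; rewrite patchE; case: ifP => // _; rewrite lee_fin.
- by apply/(measurable_restrictT _ _).1 => //; exact: measurable_funTS.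
rewrite -integral_mkcond.
under eq_integral do rewrite EFinM.
under [X in (_ = X + _)%E]eq_integral do rewrite EFinM.
rewrite !ge0_integralZl//; try (by move=> x _; rewrite lee_fin);
  try by apply/measurable_EFinP.
rewrite !integral_indic// !setIT mu1E// ge0_muleDr// integral_ge0// => x _.
by rewrite lee_fin.
Qed.

(** Read as mu1 = mu2 + g mu: adding mu2 instead of subtracting it keeps every
    term nonnegative, so that no integrability is required. The identity
    passes from simple functions to h by monotone convergence. *)
Lemma integral_density (h : T -> \bar R) : measurable_fun [set: T] h ->
  (forall x, 0 <= h x)%E ->
  (\int[mu1]_x h x = \int[mu2]_x h x + \int[mu]_x ((g x)%:E * h x))%E.
Proof.
move=> mh h0.
pose h_ := nnsfun_approx measurableT mh.
have nd x : {homo (fun n => h_ n x) : m n / (m <= n)%N >-> m <= n}.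
  by move=> m n mn; exact/lefP/nd_nnsfun_approx.
have cvgh x : (h_ n x)%:E @[n --> \oo] --> h x.
  exact: (cvg_nnsfun_approx measurableT mh (fun x _ => h0 x)).
have limh (nu : {measure set T -> \bar R}) :
    (\int[nu]_x (h_ n x)%:E @[n --> \oo] --> \int[nu]_x h x)%E.
  have -> : (\int[nu]_x h x = \int[nu]_x limn (fun n => (h_ n x)%:E))%E.
    by apply: eq_integral => x _; apply/esym/cvg_lim => //; exact: cvgh.
  apply: cvg_monotone_convergence => //.
  - by move=> n; exact/measurable_EFinP.
  - by move=> n x _; rewrite lee_fin.
  - by move=> x _ m n mn; rewrite lee_fin; exact: nd.
have limgh : (\int[mu]_x ((g x)%:E * (h_ n x)%:E) @[n --> \oo] -->
    \int[mu]_x ((g x)%:E * h x))%E.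
  have -> : (\int[mu]_x ((g x)%:E * h x) =
      \int[mu]_x limn (fun n => (g x)%:E * (h_ n x)%:E))%E.
    by apply: eq_integral => x _; apply/esym/cvg_lim => //; exact: cvgeZl.
  apply: cvg_monotone_convergence => //.
  - by move=> n; apply: emeasurable_funM => //; exact/measurable_EFinP.
  - by move=> n x _; rewrite mule_ge0// lee_fin.
  - by move=> x _ m n mn; rewrite lee_wpmul2l// lee_fin//; exact: nd.
have := limh mu1; under eq_fun do rewrite density_nnsfun.
move=> /cvg_lim <- //; apply/cvg_lim => //.
by apply: cvgeD => //; rewrite ge0_adde_def// inE integral_ge0// => x _;
  rewrite mule_ge0// lee_fin.
Qed.
End density.

(** * The inner product *)

Section inner_product.
Context {R : realType} {H : completeNormedModType R}.
Variable dot : {dot H for (idfun : R -> R)}.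
Implicit Types x y z : H.

Lemma dotC x y : dot x y = dot y x.
Proof. by rewrite hermC expr0 mul1r. Qed.

Lemma dotDl x y z : dot (x + y) z = dot x z + dot y z.
Proof. by rewrite linearDl. Qed.

Lemma dotBl x y z : dot (x - y) z = dot x z - dot y z.
Proof. by rewrite linearBl. Qed.

Lemma dotDr x y z : dot x (y + z) = dot x y + dot x z.
Proof. by rewrite dotC dotDl !(dotC x). Qed.

Lemma dotBr x y z : dot x (y - z) = dot x y - dot x z.
Proof. by rewrite dotC dotBl !(dotC x). Qed.

Lemma dot0l x : dot 0 x = 0.
Proof. by rewrite -(subrr x) dotBl subrr. Qed.

Lemma dot0r x : dot x 0 = 0.
Proof. by rewrite dotC dot0l. Qed.

Lemma dotZl (a : R) x y : dot (a *: x) y = a * dot x y.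
Proof. by rewrite linearZl_LR. Qed.

Lemma dot_polarization x y :
  4 * dot x y = dot (x + y) (x + y) - dot (x - y) (x - y).
Proof.
rewrite !dotBl !dotBr !dotDl !dotDr (dotC y x).
by lra.
Qed.

Hypothesis dot_norm : induces_norm dot.

(** Polarization reduces this to the continuity of the norm. *)
Lemma cvg_dot {T} {F : set_system T} {FF : Filter F} (f g : T -> H) x y :
  f @ F --> x -> g @ F --> y -> dot (f t) (g t) @[t --> F] --> dot x y.
Proof.
move=> fx gy.
have dotE u v : dot u v = 4^-1 * (`|u + v| ^+ 2 - `|u - v| ^+ 2).
  by rewrite -!dot_norm -dot_polarization mulKf// pnatr_eq0.
under eq_fun do rewrite dotE.
rewrite dotE; apply: cvgZr.
have sq (h : T -> H) z : h @ F --> z -> `|h t| ^+ 2 @[t --> F] --> `|z| ^+ 2.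
  move=> hz; under eq_fun do rewrite expr2.
  by rewrite expr2; apply: cvgM; exact: cvg_norm.
by apply: cvgB; apply: sq; [exact: cvgD|exact: cvgB].
Qed.
End inner_product.

(** * The scalar measures of a resolution of the identity *)

Section spectral.
Context {R : realType} {H : completeNormedModType R}.
Context {dot : {dot H for (idfun : R -> R)}}.
Hypothesis dot_norm : induces_norm dot.
Context {E : set R -> H -> H}.
Hypothesis hE : spectral_measure dot E.
Implicit Types (x y z : H) (S T : set R).

Lemma projD S x y : measurable S -> E S (x + y) = E S x + E S y.
Proof.
move=> mS; have [/(_ 1 x y) + _ _] := spectral_proj hE mS.
by rewrite /= !scale1r.
Qed.

Lemma projB S x y : measurable S -> E S (x - y) = E S x - E S y.
Proof.
move=> mS; have [/(_ (-1) y x) + _ _] := spectral_proj hE mS.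
by rewrite /= !scaleN1r ![- _ + _]addrC => ->.
Qed.

Lemma proj_sym S x y : measurable S -> dot (E S x) y = dot x (E S y).
Proof. by move=> mS; have [_ _ ->] := spectral_proj hE mS. Qed.

Lemma proj_dotI S T x y : measurable S -> measurable T ->
  dot (E S x) (E T y) = dot (E (S `&` T) x) y.
Proof.
by move=> mS mT; rewrite -proj_sym// setIC -(spectral_setI hE).
Qed.

Lemma proj_dot_ge0 S x : measurable S -> 0 <= dot (E S x) x.
Proof.
move=> mS; have := proj_dotI x x mS mS; rewrite setIid => <-.
by rewrite dot_norm.
Qed.

(** In a disjoint family of empty sets the partial sums are n E(set0) x; they
    converge, so their increment E(set0) x vanishes. *)
Lemma proj_set0 x : E set0 x = 0.
Proof.
have F0 : trivIset [set: nat] (fun _ : nat => @set0 R).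
  by apply/trivIsetP => i j _ _ _; rewrite set0I.
have := @spectral_sigma_additive _ _ _ _ hE _ x (fun=> measurable0) F0.
rewrite bigcup0//; under eq_fun do rewrite sumr_const_nat subn0.
move=> s0.
have s1 : E set0 x *+ n.+1 @[n --> \oo] --> E set0 x.
  by have := s0; rewrite -(cvg_shiftS (fun n => E set0 x *+ n)).
have : E set0 x *+ n.+1 - E set0 x *+ n @[n --> \oo] --> E set0 x - E set0 x.
  exact: cvgB.
rewrite subrr; under eq_fun do rewrite mulrS addrK.
by move/cvg_lim => <- //; rewrite lim_cst.
Qed.

(** Nothing is known of E on nonmeasurable sets, where [scalar_measure] may be
    negative; the value 0 there makes a measure of it. *)
Definition spectral_scalar x S : \bar R :=
  if `[< measurable S >] then scalar_measure dot E x S else 0%E.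

Lemma spectral_scalarE x S : measurable S ->
  spectral_scalar x S = (dot (E S x) x)%:E.
Proof. by move=> mS; rewrite /spectral_scalar asboolT. Qed.

Let spectral_scalar0 x : spectral_scalar x set0 = 0%E.
Proof. by rewrite spectral_scalarE// proj_set0 dot0l. Qed.

Let spectral_scalar_ge0 x S : (0 <= spectral_scalar x S)%E.
Proof.
rewrite /spectral_scalar; case: asboolP => // mS.
by rewrite lee_fin proj_dot_ge0.
Qed.

Let spectral_scalar_sigma x : semi_sigma_additive (spectral_scalar x).
Proof.
move=> F mF tF mUF; rewrite spectral_scalarE//.
have -> : (fun n => \sum_(0 <= i < n) spectral_scalar x (F i))%E =
    EFin \o (fun n => dot (\sum_(0 <= i < n) E (F i) x) x).
  apply/funext => n /=.
  rewrite (big_morph _ (fun u v => dotDl dot u v x) (dot0l dot x)) -sumEFin.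
  by apply: eq_bigr => i _; rewrite spectral_scalarE.
have sx := @cvg_dot _ _ _ dot_norm _ _ _ _ _ _ _
  (@spectral_sigma_additive _ _ _ _ hE F x mF tF) (cvg_cst x).
by apply: cvg_EFin; [exact: nearW|exact: sx].
Qed.

HB.instance Definition _ x := isMeasure.Build _ _ _ (spectral_scalar x)
  (spectral_scalar0 x) (spectral_scalar_ge0 x) (spectral_scalar_sigma (x:=x)).

Import HBNNSimple.

(** An integral only looks at level sets of simple functions, and these are
    measurable. *)
Lemma integral_spectral_scalar x (f : R -> \bar R) :
  (\int[scalar_measure dot E x]_l f l = \int[spectral_scalar x]_l f l)%E.
Proof.
have eqs (h : {nnsfun R >-> R}) : sintegral (scalar_measure dot E x) h =
    sintegral (spectral_scalar x) h.
  by apply: eq_fsbigr => r _; rewrite spectral_scalarE.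
by rewrite /integral; congr (_ - _)%E; congr ereal_sup; apply/seteqP; split;
  move=> _ [h hf <-]; exists h.
Qed.

(** * The norm of a spectral integral *)

Section spectral_integral.
Variables (f : R -> R) (B : operator H).
Hypothesis mf : measurable_fun [set: R] f.
Hypothesis f0 : forall l, 0 <= f l.
Hypothesis hB : is_spectral_integral dot E f B.

Lemma dom_spectral_integralP x :
  dom B x <-> (\int[spectral_scalar x]_l (f l ^+ 2)%:E < +oo)%E.
Proof. by rewrite -integral_spectral_scalar; case: hB. Qed.

(** f <= 1 + f^2, and the scalar measures are finite. *)
Lemma spectral_integral_lty x : dom B x ->
  (\int[spectral_scalar x]_l (f l)%:E < +oo)%E.
Proof.
move=> /dom_spectral_integralP fx.
apply: (@le_lt_trans _ _ (\int[spectral_scalar x]_l (1 + (f l ^+ 2)%:E))%E).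
  apply: ge0_le_integral => //.
  - by move=> l _; rewrite lee_fin.
  - exact/measurable_EFinP.
  - apply/measurable_EFinP; apply: measurable_funD => //.
    exact: measurable_funX.
  - by move=> l _; rewrite lee_fin; nra.
rewrite ge0_integralD//; first last.
- by apply/measurable_EFinP; exact: measurable_funX.
- by move=> l _; rewrite lee_fin sqr_ge0.
rewrite integral_cst// mul1e lte_add_pinfty//.
by rewrite /= spectral_scalarE// ltry.
Qed.

(** By polarization the scalar measures of x + y and x - y differ by four times
    S |-> <E(S) x, y>, that is, by the measure of density 4 g with respect to
    the scalar measure of z; integrating f then gives the claim, as the
    integral over the scalar measure of x - y is finite and can be
    subtracted. *)
Lemma spectral_integral_dot_density x y z (g : R -> R) :
  measurable_fun [set: R] g -> (forall l, 0 <= g l) ->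
  dom B x -> dom B y ->
  (forall S, measurable S ->
    (dot (E S x) y)%:E = \int[spectral_scalar z]_(l in S) (g l)%:E)%E ->
  ((dot (B x) y)%:E = \int[spectral_scalar z]_l (g l * f l)%:E)%E.
Proof.
move=> mg g0 Bx By gE.
have Bxy : dom B (x - y).
  by rewrite addrC -scaleN1r; exact: dom_linear.
have mgf : measurable_fun [set: R] (EFin \o (fun l => g l * f l)).
  by apply/measurable_EFinP; exact: measurable_funM.
have m4 : measurable_fun [set: R] (fun l => 4 * g l) by exact: measurable_funM.
have d (S : set R) : measurable S -> (spectral_scalar (x + y)%R S =
    spectral_scalar (x - y)%R S +
    \int[spectral_scalar z]_(l in S) (4 * g l)%:E)%E.
  move=> mS.
  rewrite (eq_integral (fun l => 4%:E * (g l)%:E)%E); last by [].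
  rewrite ge0_integralZl//; last 2 first.
  - by apply/measurable_EFinP; exact: measurable_funTS.
  - by move=> l _; rewrite lee_fin.
  rewrite -gE// !spectral_scalarE// -EFinM -EFinD; congr EFin.
  rewrite projD// projB// !dotBl !dotBr !dotDl !dotDr.
  by rewrite (proj_sym y x mS) (dotC dot y); lra.
have fE : (\int[spectral_scalar (x + y)%R]_l (f l)%:E =
    \int[spectral_scalar (x - y)%R]_l (f l)%:E +
    \int[spectral_scalar z]_l ((4 * g l)%:E * (f l)%:E))%E.
  apply: (integral_density m4 _ d); last by move=> l; rewrite lee_fin.
    by move=> l; rewrite mulr_ge0.
  exact/measurable_EFinP.
have := hB.2 _ _ Bx By; rewrite !integral_spectral_scalar fE.
rewrite addeAC subee ?add0e; last first.
  rewrite ge0_fin_numE ?spectral_integral_lty//.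
  by apply: integral_ge0 => l _; rewrite lee_fin.
rewrite (eq_integral (fun l => 4%:E * (g l * f l)%:E)%E); last first.
  by move=> l _; rewrite -!EFinM mulrA.
rewrite ge0_integralZl//; last by move=> l _; rewrite lee_fin mulr_ge0.
rewrite EFinM => /(congr1 (fun t => (4^-1)%:E * t)%E).
by rewrite !muleA -!EFinM mulVf ?pnatr_eq0// mul1e mul1r.
Qed.

(** The scalar measure of E(S) x is finite and carried by S, where f^2 is at
    most M^2. *)
Lemma dom_spectral_bounded S (M : R) x : measurable S ->
  (forall l, S l -> f l <= M) -> dom B (E S x).
Proof.
move=> mS fM; apply/dom_spectral_integralP.
have mf2 : measurable_fun [set: R] (EFin \o (fun l => f l ^+ 2)).
  by apply/measurable_EFinP; exact: measurable_funX.
rewrite (@ge0_negligible_integral _ _ _ _ _ (~` S))//; first last.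
- have mS' : measurable (~` S) by exact: measurableC.
  rewrite /= spectral_scalarE//.
  rewrite -(spectral_setI hE x mS' mS) setICl proj_set0.
  by rewrite dot0l.
- by move=> l _; rewrite lee_fin sqr_ge0.
- exact: measurableC.
rewrite setTD setCK.
apply: (@le_lt_trans _ _
  (\int[spectral_scalar (E S x)]_(l in S) (M ^+ 2)%:E)%E).
  apply: ge0_le_integral => //.
  - by move=> l _; rewrite lee_fin sqr_ge0.
  - exact: measurable_funTS.
  - move=> l Sl; rewrite lee_fin ler_sqr ?nnegrE ?fM//.
    exact: le_trans (fM _ Sl).
by rewrite integral_cst//= spectral_scalarE// -EFinM ltry.
Qed.

(** B x need not be in the domain of B, so |B x|^2 cannot be computed as
    <B x, y> with y = B x directly; y = E(D n) B x does belong to it, and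
    D n = [set l | f l <= n] increases to the whole line. *)
Lemma spectral_integral_norm x : dom B x ->
  ((`|B x| ^+ 2)%:E = \int[scalar_measure dot E x]_l (f l ^+ 2)%:E)%E.
Proof.
move=> Bx; rewrite integral_spectral_scalar.
pose D n := f @^-1` `]-oo, n%:R].
have mD n : measurable (D n).
  by rewrite -[D n]setTI; apply: mf.
have fD n l : D n l -> f l <= n%:R by rewrite /D /= in_itv.
(* The left-hand side is <E(S) x, E(D n) B x>; apply the density lemma to
   y = E(S `&` D n) x, with density the indicator of S `&` D n. *)
have DE n S : measurable S -> ((dot (E (S `&` D n) x) (B x))%:E =
    \int[spectral_scalar x]_(l in S) (\1_(D n) l * f l)%:E)%E.
  move=> mS; have mSD : measurable (S `&` D n) by exact: measurableI.
  rewrite dotC (@spectral_integral_dot_density _ _ x \1_(S `&` D n))//.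
  - rewrite [RHS]integral_mkcond; apply: eq_integral => l _.
    rewrite patchE indicI /=.
    by case: ifPn => lS; rewrite indicE ?(negbTE lS) ?lS ?mul1r ?mul0r.
  - by apply: (@dom_spectral_bounded _ n%:R) => // l [_]; exact: fD.
  - move=> T mT; rewrite proj_dotI// integral_indic// setIC.
    by apply/esym/spectral_scalarE; exact: measurableI.
(* Now y = E(D n) B x; by DE the density is f on D n and 0 elsewhere. *)
have BE n : (spectral_scalar (B x) (D n) =
    \int[spectral_scalar x]_(l in D n) (f l ^+ 2)%:E)%E.
  rewrite spectral_scalarE// dotC.
  rewrite (@spectral_integral_dot_density _ _ x (fun l => \1_(D n) l * f l))//.
  - rewrite [RHS]integral_mkcond; apply: eq_integral => l _.
    by rewrite patchE indicE; case: ifPn => ?; rewrite ?mul1r ?mul0r// expr2.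
  - by apply: measurable_funM.
  - by move=> l; rewrite mulr_ge0.
  - by apply: (@dom_spectral_bounded _ n%:R) => //; exact: fD.
  - by move=> S mS; rewrite proj_dotI// DE.
have Dnd : nondecreasing_seq D.
  move=> m n mn; apply/subsetPset => l.
  rewrite /D /= !in_itv/= => /le_trans; apply.
  by rewrite ler_nat.
have DT : \bigcup_n D n = setT.
  apply/seteqP; split => // l _; exists (Num.bound (f l)) => //=.
  by rewrite /D /= in_itv /=; apply/ltW/archi_boundP.
have lim1 :
    spectral_scalar (B x) (D n) @[n --> \oo] --> spectral_scalar (B x) setT.
  rewrite -DT.
  apply: (nondecreasing_cvg_mu (mu := spectral_scalar (B x))) => //.
  exact: bigcupT_measurable.
have lim2 : (\int[spectral_scalar x]_(l in D n) (f l ^+ 2)%:E @[n --> \oo] -->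
    \int[spectral_scalar x]_l (f l ^+ 2)%:E)%E.
  rewrite -DT; apply: ge0_nondecreasing_set_cvg_integral => //.
  - move=> n; apply/measurable_EFinP/measurable_funTS.
    exact: measurable_funX.
  - by move=> n l _; rewrite lee_fin sqr_ge0.
rewrite -dot_norm -[X in dot X _](spectral_setT hE) -spectral_scalarE//.
rewrite -(cvg_lim _ lim2)//; under eq_fun do rewrite -BE.
by rewrite (cvg_lim _ lim1).
Qed.

End spectral_integral.

(** * The square root of a nonnegative operator *)

Section square_root.
Variables (A B : operator H).
Hypothesis E_ge0 : forall x, E `[0, +oo[%classic x = x.
Hypothesis hA : is_spectral_integral dot E id A.
Hypothesis hB : is_spectral_integral dot E (fun l => l `^ 2^-1) B.

(** The integrands differ only on the negative half-line, a null set. *)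
Let spectral_id_sqr z :
  (\int[spectral_scalar z]_l l%:E =
   \int[spectral_scalar z]_l ((l `^ 2^-1) ^+ 2)%:E)%E.
Proof.
apply: ae_eq_integral => //.
- by apply/measurable_EFinP; apply: measurable_funX; exact: measurable_powR.
- have mI : measurable (~` `[0, +oo[%classic : set R).
    by apply: measurableC; exact: measurable_itv.
  exists (~` `[0, +oo[%classic); split => //.
  + rewrite /= spectral_scalarE// -[X in E _ X]E_ge0 -(spectral_setI hE)//.
    by rewrite setICl proj_set0 dot0l.
  + move=> l /= h; rewrite in_itv/= andbT => l0; apply: h => _.
    by rewrite powR12_sqrt// sqr_sqrtr.
Qed.

(** Both sides are the integral of l with respect to the scalar measure of x:
    the left one by [spectral_integral_norm], the right one by the definition
    of A with y = x, where x - x contributes nothing and x + x carries four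
    times the scalar measure of x. *)
Lemma norm_sqr_spectral_sqrt x : dom A x -> dom B x ->
  `|B x| ^+ 2 = dot (A x) x.
Proof.
move=> Ax Bx.
have mp : measurable_fun [set: R] (fun l : R => l `^ 2^-1).
  exact: measurable_powR.
have := @spectral_integral_norm _ _ mp (fun l => powR_ge0 _ _) hB _ Bx.
rewrite integral_spectral_scalar; set I := (X in _ = X) => BI.
have := hA.2 _ _ Ax Ax.
rewrite !integral_spectral_scalar !spectral_id_sqr.
have -> : (\int[spectral_scalar (x - x)%R]_l ((l `^ 2^-1) ^+ 2)%:E = 0)%E.
  rewrite (eq_measure_integral mzero); first exact: integral_measure_zero.
  by move=> S mS _; rewrite /= spectral_scalarE// subrr dot0r.
have -> :
    (\int[spectral_scalar (x + x)%R]_l ((l `^ 2^-1) ^+ 2)%:E = 4%:E * I)%E.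
  have mscaleE (S : set R) : measurable S ->
      spectral_scalar (x + x)%R S = mscale 4%:nng (spectral_scalar x) S.
    move=> mS; rewrite /mscale /= !spectral_scalarE// -EFinM projD//.
    by rewrite dotDl !dotDr; congr EFin; lra.
  rewrite (eq_measure_integral (mscale 4%:nng (spectral_scalar x))).
    rewrite ge0_integral_mscale//.
      by apply/measurable_EFinP; exact: measurable_funX.
    by move=> l _; rewrite lee_fin sqr_ge0.
  by move=> S mS _; exact: mscaleE.
by rewrite sube0 -BI -EFinM => -[BA]; lra.
Qed.
End square_root.

End spectral.

(** * Derivatives on the half-line *)

Section half_line.
Context {R : realType}.

Local Notation punctured_at t :=
  (within [set s | 0 <= s /\ s != t] (nbhs t)).

(** One-sided at t = 0, two-sided elsewhere. *)
Definition derivative_at {V : normedModType R} (phi : R -> V) (t : R) (l : V) :=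
  (s - t)^-1 *: (phi s - phi t) @[s --> punctured_at t] --> l.

Lemma punctured_at_proper (t : R) : 0 <= t -> ProperFilter (punctured_at t).
Proof.
move=> t0; apply: Build_ProperFilter_ex => P.
move=> /nbhs_ballP[e /= e0 Pe].
exists (t + e / 2); apply: Pe; first last.
  by split; [rewrite addr_ge0// divr_ge0// ltW|rewrite gt_eqF// ltrDl divr_gt0].
rewrite /ball /= opprD addrA subrr sub0r normrN gtr0_norm ?divr_gt0//.
by rewrite ltr_pdivrMr// ltr_pMr// ltr1n.
Qed.

Lemma derivative_at_continuous {V : normedModType R} (phi : R -> V) (t : R) l :
  derivative_at phi t l ->
  phi s @[s --> within [set s | 0 <= s] (nbhs t)] --> phi t.
Proof.
move=> dphi.
have phiE : phi s @[s --> punctured_at t] --> phi t.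
  have s0 : s - t @[s --> punctured_at t] --> (0 : R).
    rewrite -(subrr t); apply: cvgB; last exact: cvg_cst.
    exact: (cvg_within (F := nbhs t)).
  have lim : (s - t) *: ((s - t)^-1 *: (phi s - phi t)) + phi t
      @[s --> punctured_at t] --> phi t.
    rewrite -[X in _ --> X]add0r -(scale0r l).
    by apply: cvgD; [exact: cvgZ|exact: cvg_cst].
  refine (cvg_trans _ lim); apply: near_eq_cvg.
  rewrite near_withinE; apply: nearW => s [_ st].
  by rewrite scalerA divff ?subr_eq0// scale1r subrK.
move=> A At; have phiA : \forall s \near t, 0 <= s /\ s != t -> A (phi s).
  exact: phiE.
change (\forall s \near t, 0 <= s -> A (phi s)).
near=> s => s0; have [->|st] := eqVneq s t; first exact: nbhs_singleton.
have phiAs : 0 <= s /\ s != t -> A (phi s) by near: s.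
exact: phiAs.
Unshelve. all: by end_near. Qed.

Lemma derivative_at_is_derive (phi : R -> R) (t l : R) : 0 < t ->
  derivative_at (phi : R -> R^o) t l -> is_derive t 1 phi l.
Proof.
move=> t0 dphi.
suff dq : h^-1 *: (phi (h *: 1 + t) - phi t) @[h --> 0^'] --> (l : R^o).
  by apply: DeriveDef; [apply/cvg_ex; exists l|exact/cvg_lim].
have sh : h + t @[h --> (0 : R)^'] --> punctured_at t.
  move=> P /nbhs_ballP[e /= e0 Pe].
  rewrite !near_simpl /=.
  near=> h; apply: Pe.
    rewrite /ball /= opprD addrCA subrr addr0 normrN.
    by near: h; exact: dnbhs0_lt.
  split; last by rewrite -subr_eq0 addrK; near: h; exact: nbhs_dnbhs_neq.
  have : `|h| < t by near: h; exact: dnbhs0_lt.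
  by rewrite ltr_norml => /andP[+ _]; rewrite -subr_gt0 opprK => /ltW.
refine (cvg_trans _ (cvg_comp _ _ sh dphi)); apply: near_eq_cvg; near=> h => /=.
by rewrite addrK [h *: 1]mulr1.
Unshelve. all: by end_near. Qed.

Lemma has_derivative_at {H : completeNormedModType R} (u v : R -> H) (t : R) :
  has_derivative Num.norm u v -> 0 <= t -> derivative_at u t (v t).
Proof. by move=> uv t0; apply/subr_cvg0; apply: norm_cvg0; exact: uv. Qed.

Lemma derivativeE {H : completeNormedModType R} (u : R -> H) (t : R) l :
  0 <= t -> derivative_at u t l -> derivative u t = l.
Proof.
move=> t0 dul; have FF := punctured_at_proper t0.
by apply: cvg_lim => //; exact: dul.
Qed.

Lemma is_derive_continuous (f : R -> R) (t l : R) :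
  is_derive t 1 f l -> {for t, continuous f}.
Proof.
move=> ft; apply: differentiable_continuous.
by rewrite -derivable1_diffP.
Qed.

End half_line.

Section quadratic.
Context {R : realType} {H : completeNormedModType R}.
Context {dot : {dot H for (idfun : R -> R)}}.
Hypothesis dot_norm : induces_norm dot.

(** The symmetry relation turns the difference quotient of <L s, u s> into
    <L s + L t, (u s - u t) / (s - t)>, which involves L only through its
    continuity. With L = A u it differentiates <A u, u> although A u need not
    be differentiable; with L = u it differentiates |u|^2. *)
Lemma derivative_at_dot (L u : R -> H) (t : R) (v : H) :
  L s @[s --> within [set s | 0 <= s] (nbhs t)] --> L t ->
  derivative_at u t v ->
  (forall s, 0 <= s -> dot (L s) (u t) = dot (L t) (u s)) ->
  derivative_at (fun s => dot (L s) (u s) : R^o) t (2 * dot (L t) v).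
Proof.
move=> cL du Lsym.
have cL' : L s @[s --> within [set s | 0 <= s /\ s != t] (nbhs t)] --> L t.
  by apply: cvg_trans cL; apply: cvg_fmap2; apply: within_subset => s [].
have -> : 2 * dot (L t) v = dot (L t + L t) v by rewrite dotDl; lra.
have lim : dot (L s + L t) ((s - t)^-1 *: (u s - u t))
    @[s --> within [set s | 0 <= s /\ s != t] (nbhs t)] --> dot (L t + L t) v.
  by apply: (cvg_dot dot_norm) => //; apply: cvgD => //; exact: cvg_cst.
refine (cvg_trans _ lim); apply: near_eq_cvg.
rewrite near_withinE; apply: nearW => s [s0 _].
rewrite [in LHS]dotC dotZl dotC dotDl !dotBr Lsym//.
by rewrite addrA subrK.
Qed.

Lemma self_adjoint_symmetric (A : operator H) x y : self_adjoint dot A ->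
  dom A x -> dom A y -> dot (A x) y = dot x (A y).
Proof. by move=> [_ A_sa] Ax Ay; exact: ((A_sa y (A y)).2 (conj Ay erefl)). Qed.

Lemma C0_graph_continuous (A : operator H) (u : R -> H) (t : R) :
  Ck (dom A) (graph_norm A) 0 u -> 0 <= t ->
  A (u s) @[s --> within [set s | 0 <= s] (nbhs t)] --> A (u t).
Proof.
move=> [Adom uc] t0; apply/subr_cvg0; apply: norm_cvg0.
have := uc t t0; apply: squeeze_cvgr; last exact: cvg_cst.
rewrite near_withinE; apply: nearW => s s0; rewrite normr_ge0 /=.
have -> : A (u s) - A (u t) = A (u s - u t).
  have := app_linear (-1) (Adom t t0) (Adom s s0).
  by rewrite !scaleN1r addrC => ->; rewrite addrC.
rewrite /graph_norm -[leLHS]ger0_norm// -sqrtr_sqr ler_wsqrtr//.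
by rewrite lerDr sqr_ge0.
Qed.
End quadratic.

(** * Antiderivatives and a differential inequality *)

Section antiderivative.
Context {R : realType}.
Notation mu := (@lebesgue_measure R).

(** The derivative at 0 is two-sided: the argument |A^(1/2) u|^2 of M may
    vanish at an interior time, where the chain rule needs a neighborhood of 0.
    To this end m is extended by its value at 0 and integrated from -1. *)
Lemma antiderivative_half_line (m : R -> R) :
  {within `[0, +oo[, continuous m} ->
  exists M : R -> R,
    (forall s : R, 0 <= s -> is_derive s 1 M (m s)) /\
    forall s : R, 0 <= s -> (\int[mu]_(x in `[0%R, s]) (m x)%:E)%E = (M s)%:E.
Proof.
move=> mc.
pose n (x : R) := m (Num.max x 0).
have nc : continuous n.
  move=> x.
  have mx : m z @[z --> within `[0, +oo[%classic (nbhs (Num.max x 0))] --> n x.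
    move/subspace_continuousP : mc; apply.
    by rewrite /= in_itv/= andbT le_max lexx orbT.
  refine (cvg_comp _ _ _ mx) => P.
  have maxc : Num.max z 0 @[z --> x] --> Num.max x 0.
    by apply: (@continuous_max _ _ id (cst 0)); [exact: cvg_id|exact: cvg_cst].
  move=> /maxc; rewrite !near_simpl => H.
  change (\forall z \near x, P (Num.max z 0)).
  by apply: filterS H => z; apply; rewrite /= in_itv/= andbT le_max lexx orbT.
have nE (x : R) : 0 <= x -> n x = m x by move=> x0; rewrite /n max_l.
pose F (y : R) : R := \int[mu]_(t in `[(-1)%R, y]) n t.
have dF (x : R) : 0 <= x -> derivable F x 1 /\ derive1 F x = n x.
  move=> x0; apply: (@continuous_FTC1_closed _ n (-1) x (x + 1)).
  - by rewrite ltrDl.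
  - apply: continuous_compact_integrable; first exact: segment_compact.
    exact: continuous_subspaceT.
  - by rewrite (lt_le_trans _ x0)// ltrN10.
  - exact: nc.
have dM (x : R) : 0 <= x -> is_derive x 1 (fun y => F y - F 0) (m x).
  move=> x0; have [dFx Fx] := dF x x0.
  rewrite -(subr0 (m x)) -nE// -Fx derive1E.
  by apply: is_deriveB; exact: derivableP.
exists (fun y => F y - F 0); split=> // s; rewrite le_eqVlt => /predU1P[<-|s0].
  by rewrite set_itv1 integral_set1 subrr.
have -> : (\int[mu]_(x in `[0%R, s]) (m x)%:E =
    \int[mu]_(x in `[0%R, s]) (n x)%:E)%E.
  apply: eq_integral => x; rewrite inE /= in_itv/= => /andP[x0 _].
  by rewrite nE.
rewrite (@continuous_FTC2 _ n (fun y => F y - F 0) 0 s)//.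
- by rewrite subrr sube0.
- exact: continuous_subspaceT.
- have cM (x : R) : 0 <= x -> {for x, continuous (fun y => F y - F 0)}.
    by move=> /dM; exact: is_derive_continuous.
  split; first by move=> x; rewrite in_itv/= => /andP[/ltW/dM].
  + by apply: cvg_at_right_filter; exact: cM.
  + by apply: cvg_at_left_filter; apply: cM; exact: ltW.
- move=> x; rewrite in_itv/= => /andP[/ltW x0 _].
  by rewrite derive1E nE//; have dMx := dM x x0; exact: derive_val.
Qed.

Lemma half_line_integral_le (f : R -> R) (t : R) :
  {within `[0, +oo[, continuous f} -> (forall s, 0 <= s -> 0 <= f s) ->
  (\int[mu]_(s in `[0%R, t]) (f s)%:E <=
   \int[mu]_(s in `[0%R, +oo[) (f s)%:E)%E.
Proof.
move=> cf f0; apply: ge0_subset_integral => //.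
- by apply/measurable_EFinP; exact: subspace_continuous_measurable_fun.
- by move=> x; rewrite /= in_itv/= andbT lee_fin => /f0.
- by move=> x; rewrite /= !in_itv/= => /andP[->].
Qed.

End antiderivative.

Section lower_bounds.
Context {R : realType}.

(** The product e exp(k B) is nondecreasing, its derivative being
    exp(k B) (e' + k b e). *)
Lemma gronwall_lower_bound (e de b B : R -> R) (k : R) :
  {within `[0, +oo[, continuous e} ->
  (forall t : R, 0 < t -> is_derive t 1 e (de t)) ->
  (forall t : R, 0 <= t -> is_derive t 1 B (b t)) ->
  (forall t : R, 0 < t -> - (k * b t) * e t <= de t) ->
  forall t : R, 0 <= t -> e 0 * expR (k * B 0) <= e t * expR (k * B t).
Proof.
move=> ce dE dB deE t t0.
pose G (x : R) : R := e x * expR (k * B x).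
have dexp (x : R) : 0 <= x -> is_derive x 1
    (fun y => expR (k * B y)) (expR (k * B x) * (k * b x)).
  move=> x0; have dBx := dB x x0.
  exact: (@is_derive1_comp _ expR (fun y => k * B y)).
have dG (x : R) : 0 < x -> is_derive x 1 G
    (e x * (expR (k * B x) * (k * b x)) + expR (k * B x) * de x).
  move=> x0; have dex := dE x x0; have dEx := dexp x (ltW x0).
  exact: is_deriveM.
have mem0 : 0 \in `[0, t] by rewrite in_itv/= lexx.
have memt : t \in `[0, t] by rewrite in_itv/= lexx andbT.
apply: (@ger0_derive1_le_cc _ G 0 t) => //.
- by move=> x; rewrite in_itv/= => /andP[x0 _]; have := dG x x0 => dGx.
- move=> x; rewrite in_itv/= => /andP[x0 _]; have dGx := dG x x0.
  rewrite derive1E derive_val mulrCA -mulrDr mulr_ge0 ?expR_ge0//.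
  by have := deE x x0; rewrite mulNr lerNl; lra.
- have cG : {within `[0, +oo[, continuous G}.
    apply/subspace_continuousP => x x0; apply: cvgM.
      by move/subspace_continuousP : ce; exact.
    apply: cvg_within_filter.
    have /dexp dEx : 0 <= x by move: x0; rewrite /= in_itv/= andbT.
    exact: (is_derive_continuous dEx).
  apply: (continuous_subspaceW _ cG) => x /=.
  by rewrite !in_itv/= => /andP[->].
Qed.

Lemma limf_einf_pinfty_gt0 (f : R -> R) (c : R) : 0 < c ->
  (forall t : R, 0 <= t -> c <= f t) ->
  (0 < limf_einf (fun t => (f t)%:E) (pinfty_nbhs R))%E.
Proof.
move=> c0 cf; rewrite limf_einfE.
apply: (@lt_le_trans _ _ c%:E); first by rewrite lte_fin.
apply: (@le_trans _ _ (ereal_inf ((EFin \o f) @` [set t | 0 <= t]))).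
  by apply: le_ereal_inf_tmp => _ [t /= t0 <-]; rewrite lee_fin cf.
apply: ereal_sup_ubound; exists [set t | 0 <= t] => //.
by exists 0; split => // x /ltW.
Qed.

End lower_bounds.

(** * Persistence of the energy *)

Unset Implicit Arguments.
Set Strict Implicit.

Theorem theorem2p3 (R : realType) (H : completeNormedModType R)
  (dot : {dot H for (idfun : R -> R)}) (dot_norm : induces_norm dot)
  (A : operator H) (A_sa : self_adjoint dot A) (A_ge0 : nonnegative dot A)
  (Ahalf : operator H) (AhalfE : is_power dot A 2^-1 Ahalf)
  (m : R -> R) (m_ge0 : forall s : R, 0 <= s -> 0 <= m s)
  (m_cont : {within `[0, +oo[, continuous m})
  (b : R -> R) (b_gt0 : forall s : R, 0 <= s -> 0 < b s)
  (b_cont : {within `[0, +oo[, continuous b})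
  (b_int : (\int[lebesgue_measure]_(s in `[0%R, +oo[) (b s)%:E < +oo)%E)
  (u0 u1 : H) (u0_dom : dom A u0) (u1_dom : dom Ahalf u1)
  (energy_gt0 : 0 < `|u1| ^+ 2 +
    \int[lebesgue_measure]_(s in `[0, `|Ahalf u0| ^+ 2]) m s)
  (eps : R) (eps_gt0 : 0 < eps)
  (u : R -> H)
  (u_C2 : Ck setT Num.norm 2 u)
  (u_C1 : Ck (dom Ahalf) (graph_norm Ahalf) 1 u)
  (u_C0 : Ck (dom A) (graph_norm A) 0 u)
  (u_eq : forall t : R, 0 <= t ->
    eps *: derivative (derivative u) t + b t *: derivative u t
      + m (`|Ahalf (u t)| ^+ 2) *: A (u t) = 0)
  (u_0 : u 0 = u0) (u'_0 : derivative u 0 = u1) :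
  (0 < limf_einf (fun t => (`|derivative u t| ^+ 2 + `|Ahalf (u t)| ^+ 2)%:E)
         (pinfty_nbhs R))%E.

Proof.
case: AhalfE => E [hE E_ge0 hA hB].
have [_ [v uv [_ [w vw _]]]] := u_C2.
have Adom (t : R) : 0 <= t -> dom A (u t) by case: u_C0 => + _; apply.
have Bdom (t : R) : 0 <= t -> dom Ahalf (u t) by case: u_C1 => + _; apply.
have duv (t : R) : 0 <= t -> derivative_at u t (v t).
  exact: has_derivative_at.
have dvw (t : R) : 0 <= t -> derivative_at v t (w t).
  exact: has_derivative_at.
have u'E (t : R) : 0 <= t -> derivative u t = v t.
  by move=> t0; apply: derivativeE => //; exact: duv.
have u''E (t : R) : 0 <= t -> derivative (derivative u) t = w t.
  move=> t0; apply: derivativeE => //; refine (cvg_trans _ (dvw t t0)).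
  apply: near_eq_cvg; rewrite near_withinE; apply: nearW => s [s0 _].
  by rewrite !u'E.
pose phi (t : R) := dot (A (u t)) (u t).
pose psi (t : R) := dot (v t) (v t).
have phiE (t : R) : 0 <= t -> `|Ahalf (u t)| ^+ 2 = phi t.
  by move=> t0; apply: (norm_sqr_spectral_sqrt dot_norm hE E_ge0 hA hB); auto.
have phi_ge0 (t : R) : 0 <= t -> 0 <= phi t.
  by move=> t0; apply: A_ge0; exact: Adom.
have dphi (t : R) : 0 <= t ->
    derivative_at (phi : R -> R^o) t (2 * dot (A (u t)) (v t)).
  move=> t0; apply: (derivative_at_dot dot_norm); [|exact: duv|].
  - exact: C0_graph_continuous.
  - move=> s s0.
    by rewrite (self_adjoint_symmetric A_sa (Adom s s0) (Adom t t0)) dotC.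
have dpsi (t : R) : 0 <= t ->
    derivative_at (psi : R -> R^o) t (2 * dot (v t) (w t)).
  move=> t0; apply: (derivative_at_dot dot_norm); [|exact: dvw|].
  - exact: derivative_at_continuous (dvw t t0).
  - by move=> s _; rewrite dotC.
have [M [dM ME]] := antiderivative_half_line m_cont.
have cM (s : R) : 0 <= s -> {for s, continuous M}.
  by move=> /dM; exact: is_derive_continuous.
have [B [dB BE]] := antiderivative_half_line b_cont.
have M_ge0 (s : R) : 0 <= s -> 0 <= M s.
  move=> s0; rewrite -lee_fin -ME//; apply: integral_ge0 => x.
  by rewrite /= in_itv/= lee_fin => /andP[/m_ge0].
have B0 : B 0 = 0 by apply: EFin_inj; rewrite -BE// set_itv1 integral_set1.
pose C := fine (\int[lebesgue_measure]_(s in `[0%R, +oo[) (b s)%:E)%E.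
have BC (t : R) : 0 <= t -> B t <= C.
  move=> t0; rewrite -lee_fin -BE// fineK.
    by apply: half_line_integral_le => // s /b_gt0/ltW.
  rewrite ge0_fin_numE// integral_ge0// => x.
  by rewrite /= in_itv/= andbT lee_fin => /b_gt0/ltW.
pose e (t : R) := eps * psi t + M (phi t).
pose de (t : R) :=
  eps * (2 * dot (v t) (w t)) + m (phi t) * (2 * dot (A (u t)) (v t)).
have de_e (t : R) : 0 < t -> is_derive t 1 e (de t).
  move=> t0; have t0' := ltW t0.
  have dphit := derivative_at_is_derive t0 (dphi t t0').
  have dpsit := derivative_at_is_derive t0 (dpsi t t0').
  have dMt := dM (phi t) (phi_ge0 t t0').
  have dMphi := is_derive1_comp dMt dphit.
  by apply: is_deriveD.
have ce : {within `[0, +oo[, continuous e}.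
  apply/subspace_continuousP => x; rewrite set_itvcy /= => x0.
  apply: cvgD.
    by apply: cvgZr; exact: derivative_at_continuous (dpsi x x0).
  have cphi := derivative_at_continuous (dphi x x0).
  exact: (cvg_comp _ _ cphi (cM _ (phi_ge0 x x0))).
(* The equation, tested against u'. *)
have deE (t : R) : 0 <= t -> de t = - (2 * b t * psi t).
  move=> t0; have := u_eq t t0; rewrite u''E// u'E// phiE// => eq0.
  have := congr1 (dot^~ (v t)) eq0.
  rewrite /= !dotDl !dotZl dot0l (dotC dot (w t)) => eq1.
  rewrite /de /psi; lra.
have deE_ge (s : R) : 0 < s -> - (2 / eps * b s) * e s <= de s.
  move=> /ltW s0; have b0 := b_gt0 s s0; rewrite deE//.
  have -> : - (2 / eps * b s) * e s =
      - (2 * b s * psi s) - 2 / eps * b s * M (phi s).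
    by rewrite /e; field; rewrite gt_eqF.
  rewrite gerBl !mulr_ge0 ?invr_ge0 ?M_ge0 ?phi_ge0//; exact: ltW.
have e_ge (t : R) : 0 <= t -> e 0 <= e t * expR (2 / eps * C).
  move=> t0; have := gronwall_lower_bound ce de_e dB deE_ge t0.
  rewrite B0 mulr0 expR0 mulr1 => /le_trans; apply; rewrite ler_wpM2l//.
    rewrite addr_ge0 ?mulr_ge0 ?M_ge0 ?phi_ge0 ?(ltW eps_gt0)//.
    by rewrite /psi dot_norm.
  by rewrite ler_expR ler_wpM2l ?divr_ge0 ?(ltW eps_gt0)// BC.
have e0_gt0 : 0 < e 0.
  have l0 : 0 <= (0 : R) by [].
  have := energy_gt0; rewrite /Rintegral -u_0 phiE// ME ?phi_ge0//= -u'_0 u'E//.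
  rewrite -dot_norm -/(psi 0) /e.
  have psi0 : 0 <= psi 0 by rewrite /psi dot_norm.
  have := M_ge0 _ (phi_ge0 0 l0).
  rewrite le_eqVlt => /predU1P[<-|M0 _].
    by rewrite !addr0; exact: mulr_gt0.
  by rewrite ltr_wpDl// mulr_ge0// ltW.
pose c0 := e 0 / expR (2 / eps * C).
have c0_gt0 : 0 < c0 by rewrite divr_gt0// expR_gt0.
have c0_le (t : R) : 0 <= t -> c0 <= e t.
  by move=> t0; rewrite ler_pdivrMr ?expR_gt0//; exact: e_ge.
(* A time with psi < c0 / (2 eps) and phi < d would have energy below c0. *)
have [d d_gt0 Md] :
    exists2 d, 0 < d & forall s : R, 0 <= s -> s < d -> M s < c0 / 2.
  have M0 : M 0 = 0 by apply: EFin_inj; rewrite -ME// set_itv1 integral_set1.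
  have cM0 := cM 0 (lexx 0).
  have c2 : 0 < c0 / 2 by rewrite divr_gt0.
  have /nbhs_ballP[d /= d0 Md] : \forall x \near 0, M x < c0 / 2.
    by apply: (cvgr_lt _ cM0); rewrite M0.
  exists d => // s s0 sd; apply: Md.
  by rewrite /ball /= sub0r normrN ger0_norm.
pose c := Num.min d (c0 / (2 * eps)).
have c_gt0 : 0 < c by rewrite lt_min d_gt0 divr_gt0// mulr_gt0.
have c_le (t : R) : 0 <= t -> c <= `|derivative u t| ^+ 2 + `|Ahalf (u t)| ^+ 2.
  move=> t0; rewrite u'E// phiE// -dot_norm -/(psi t).
  rewrite leNgt lt_min; apply/negP => /andP[ltd ltc].
  have psi0 : 0 <= psi t by rewrite /psi dot_norm.
  have phi0 := phi_ge0 t t0.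
  have Mlt : M (phi t) < c0 / 2 by apply: Md => //; lra.
  have psilt : psi t < c0 / (2 * eps) by lra.
  move: psilt; rewrite ltr_pdivlMr ?mulr_gt0// => psilt.
  have := c0_le t t0; rewrite /e; lra.
exact: limf_einf_pinfty_gt0 c_gt0 c_le.
Qed.
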